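(* Let $W$ be a $\phi$-coordinated $V_{\mathfrak{L}}(\ell_{123},0)$-module. Then $W$ is a restricted $\mathcal{L}$-module of level $\ell_{123}$, on which $\widehat{L}(x):=\sum_{n}L_nx^{-n}-\frac{\ell_1}{24}$ acts as $Y_W(\overline{L}_{-1}\mathbf{1},x)$ and $\widehat{I}(x):=\sum_nI_nx^{-n}-\ell_2$ acts as $Y_W(\overline{I}_{-1}\mathbf{1},x)$.
   Context: The rank one twisted Heisenberg–Virasoro algebra $\mathcal{L}$ is the complex Lie algebra with basis $\{L_n,I_n,c_1,c_2,c_3: n\in\mathbb{Z}\}$ and brackets $[L_m,L_n]=(m-n)L_{m+n}+\delta_{m+n,0}\frac{m^3-m}{12}c_1$, $[L_m,I_n]=-nI_{m+n}-\delta_{m+n,0}(m^2+m)c_2$, $[I_m,I_n]=m\delta_{m+n,0}c_3$, and $c_1,c_2,c_3$ central. An $\mathcal{L}$-module $W$ is restricted if for each $w\in W$, $L_nw=0$ and $I_nw=0$ for $n$ sufficiently large; it is of level $\ell_{123}=(\ell_1,\ell_2,\ell_3)\in\mathbb{C}^3$ if $c_i$ acts as the scalar $\ell_i$, $i=1,2,3$. Let $\mathfrak{L}$ be the Lie algebra with basis $\{\overline{L}_n,\overline{I}_n,c_1,c_2,c_3:n\in\mathbb{Z}\}$ and brackets $[\overline{L}_m,\overline{L}_n]=(m-n)\overline{L}_{m+n-1}+\frac{m(m-1)(m-2)}{12}\delta_{m+n-2,0}c_1$, $[\overline{L}_m,\overline{I}_n]=-n\overline{I}_{m+n-1}-(m^2-m)\delta_{m+n-1,0}c_2$,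 $[\overline{I}_m,\overline{I}_n]=m\delta_{m+n,0}c_3$, $c_i$ central. Let $\mathfrak{L}_{\ge0}=\mathrm{span}\{\overline{L}_n,\overline{I}_n:n\ge0\}\oplus\sum_i\mathbb{C}c_i$ act on $\mathbb{C}$ with $\overline L_n,\overline I_n$ ($n\ge0$) acting as $0$ and $c_i$ as $\ell_i$, and $V_{\mathfrak{L}}(\ell_{123},0)=U(\mathfrak{L})\otimes_{U(\mathfrak{L}_{\ge0})}\mathbb{C}$, $\mathbf{1}=1\otimes1$; it is a vertex algebra with vacuum $\mathbf{1}$, $Y(\overline{L}_{-1}\mathbf{1},x)=\sum_n\overline{L}_nx^{-n-1}$, $Y(\overline{I}_{-1}\mathbf{1},x)=\sum_n\overline{I}_nx^{-n-1}$, generated by $\overline{L}_{-1}\mathbf{1},\overline{I}_{-1}\mathbf{1}$. A $\phi$-coordinated module ($\phi(x,z)=xe^z$) for a vertex algebra $V$ is a space $W$ with a linear map $Y_W(\cdot,x):V\to\mathrm{Hom}(W,W((x)))$ such that $Y_W(\mathbf{1},x)=\mathbf{1}_W$ (identity) and for $u,v\in V$ there is $k\in\mathbb{N}$ with $(x_1-x_2)^kY_W(u,x_1)Y_W(v,x_2)\in\mathrm{Hom}(W,W((x_1,x_2)))$ and $(x_2e^z-x_2)^kY_W(Y(u,z)v,x_2)=((x_1-x_2)^kY_W(u,x_1)Y_W(v,x_2))|_{x_1=x_2e^z}$. *)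

(* Defs.v *)
From HB Require Import structures.
From mathcomp Require Import all_boot all_order all_algebra.
Set Implicit Arguments. Unset Strict Implicit. Unset Printing Implicit Defensive.
Import Order.TTheory GRing.Theory Num.Theory.
Local Open Scope ring_scope.

(* Conventions.
   A formal series  Σ_n s_n x^n  is represented by its coefficient function
   s : int -> X  ("exponent indexing": s n = coefficient of x^n).
   A vertex operator  Y(u,x)v  is represented by  Y u n v = coefficient of x^n.
   The usual mode u_n (with Y(u,x) = Σ u_n x^{-n-1}) is  mode Y u n. *)

Definition lin_op (F : fieldType) (M N : lmodType F) (f : M -> N) : Prop :=
  forall (a : F) (x y : M), f (a *: x + y) = a *: f x + f y.

(* M is a module for the Lie algebra 𝔏 (operators Lb n, Ib n for  \bar L_n, \bar I_n),
   on which c_1, c_2, c_3 act as l1, l2, l3. *)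
Definition frakL_module (F : fieldType) (M : lmodType F) (l1 l2 l3 : F)
  (Lb Ib : int -> M -> M) : Prop :=
  [/\ (forall n, lin_op (Lb n)), (forall n, lin_op (Ib n)),
   (forall (m n : int) (v : M),
      Lb m (Lb n v) - Lb n (Lb m v) =
      (m - n)%:~R *: Lb (m + n - 1) v
      + (if m + n - 2 == 0 then (m * (m - 1) * (m - 2))%:~R / 12%:R * l1 else 0) *: v),
   (forall (m n : int) (v : M),
      Lb m (Ib n v) - Ib n (Lb m v) =
      - (n%:~R *: Ib (m + n - 1) v)
      - (if m + n - 1 == 0 then (m * m - m)%:~R * l2 else 0) *: v)
 & (forall (m n : int) (v : M),
      Ib m (Ib n v) - Ib n (Ib m v) = (if m + n == 0 then m%:~R * l3 else 0) *: v)].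

Definition frakL_vacuum_module (F : fieldType) (M : lmodType F) (l1 l2 l3 : F)
  (Lb Ib : int -> M -> M) (vac : M) : Prop :=
  frakL_module l1 l2 l3 Lb Ib /\
  (forall n : int, 0 <= n -> Lb n vac = 0 /\ Ib n vac = 0).

(* Universal property of the induced module  V_𝔏(l123,0) = U(𝔏) ⊗_{U(𝔏_{>=0})} C
   with generator vac = 1 ⊗ 1 (this characterizes it up to unique isomorphism). *)
Definition induced_universal (F : fieldType) (V : lmodType F) (l1 l2 l3 : F)
  (Lb Ib : int -> V -> V) (vac : V) : Prop :=
  forall (M : lmodType F) (LM IM : int -> M -> M) (m : M),
    frakL_vacuum_module l1 l2 l3 LM IM m ->
    exists f : V -> M,
      [/\ lin_op f, f vac = m,
          (forall n v, f (Lb n v) = LM n (f v)),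
          (forall n v, f (Ib n v) = IM n (f v))
        & (forall g : V -> M, lin_op g -> g vac = m ->
             (forall n v, g (Lb n v) = LM n (g v)) ->
             (forall n v, g (Ib n v) = IM n (g v)) ->
             forall v, g v = f v)].

Definition mode (F : fieldType) (V : lmodType F) (Y : V -> int -> V -> V)
  (u : V) (n : int) (v : V) : V := Y u (- n - 1) v.

Definition binz (F : fieldType) (r : int) (i : nat) : F :=
  (\prod_(j < i) (r - (j : nat)%:Z)%:~R) / (i`!)%:R.

(* Vertex algebra axioms (truncation, vacuum, creation, Jacobi identity in the
   equivalent Borcherds-identity form; sums are finite, cut off at any B beyond
   which all terms vanish). *)
Definition vertex_algebra (F : fieldType) (V : lmodType F)
  (Y : V -> int -> V -> V) (vac : V) : Prop :=
  [/\ (forall n v, lin_op (fun u => Y u n v)) /\ (forall u n, lin_op (Y u n)),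
      (forall u v, exists N : int, forall n, n < N -> Y u n v = 0),
      (forall n v, Y vac n v = if n == 0 then v else 0),
      ((forall u n, n < 0 -> Y u n vac = 0) /\ (forall u, Y u 0 vac = u))
    & (forall (u v w : V) (p q r : int) (B : nat),
        (forall i : nat, (B <= i)%N ->
           [/\ mode Y u (r + i%:Z) v = 0, mode Y v (q + i%:Z) w = 0
             & mode Y u (p + i%:Z) w = 0]) ->
        \sum_(i < B) binz F p i *: mode Y (mode Y u (r + (i : nat)%:Z) v) (p + q - (i : nat)%:Z) w =
        \sum_(i < B) ((-1) ^+ i * binz F r i) *:
            (mode Y u (p + r - (i : nat)%:Z) (mode Y v (q + (i : nat)%:Z) w)
             - (-1) ^+ (absz r) *: mode Y v (q + r - (i : nat)%:Z) (mode Y u (p + (i : nat)%:Z) w)))].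

(* coefficient of z^j in (e^z - 1)^k *)
Definition expk_coef (F : fieldType) (k j : nat) : F :=
  (\sum_(i < k.+1) ('C(k, i)%:R * (-1) ^+ (k - i) * ((i : nat)%:R) ^+ j)) / (j`!)%:R.

(* coefficient of x1^a x2^b in (x1 - x2)^k Y_W(u,x1) Y_W(v,x2) w *)
Definition prod_coef (F : fieldType) (V W : lmodType F) (YW : V -> int -> W -> W)
  (u v : V) (k : nat) (w : W) (a b : int) : W :=
  \sum_(i < k.+1) ('C(k, i)%:R * (-1) ^+ (i : nat)) *:
     YW u (a - (k - i)%:Z) (YW v (b - (i : nat)%:Z) w).

(* coefficient of x2^m z^p in (x2 e^z - x2)^k Y_W(Y(u,z)v, x2) w,
   given M with Y u n v = 0 for n < M *)
Definition lhs_coef (F : fieldType) (V W : lmodType F) (Y : V -> int -> V -> V)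
  (YW : V -> int -> W -> W) (u v : V) (k : nat) (w : W) (M m p : int) : W :=
  \sum_(j < (absz (p - M)%R).+1)
     expk_coef F k j *: YW (Y u (p - (j : nat)%:Z) v) (m - k%:Z) w.

(* coefficient of x2^m z^p in ((x1 - x2)^k Y_W(u,x1) Y_W(v,x2) w)|_{x1 = x2 e^z},
   given N with prod_coef ... a b = 0 whenever a < N or b < N *)
Definition rhs_coef (F : fieldType) (V W : lmodType F) (YW : V -> int -> W -> W)
  (u v : V) (k : nat) (w : W) (N m p : int) : W :=
  match p with
  | Posz p' =>
      \sum_(t < (absz (m - N - N)%R).+1)
        (((N + (t : nat)%:Z)%:~R ^+ p') / (p'`!)%:R) *:
          prod_coef YW u v k w (N + (t : nat)%:Z) (m - N - (t : nat)%:Z)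
  | Negz _ => 0
  end.

(* φ-coordinated module, φ(x,z) = x e^z, for the vertex algebra (V, Y, vac). *)
Definition phi_coordinated_module (F : fieldType) (V : lmodType F)
  (Y : V -> int -> V -> V) (vac : V) (W : lmodType F) (YW : V -> int -> W -> W) : Prop :=
  [/\ (forall n w, lin_op (fun u => YW u n w)),
      (forall u n, lin_op (YW u n)),
      (forall u w, exists N : int, forall n, n < N -> YW u n w = 0),
      (forall n w, YW vac n w = if n == 0 then w else 0)
    & (forall u v : V, exists k : nat, forall w : W, exists N : int,
         (forall a b : int, (a < N) || (b < N) -> prod_coef YW u v k w a b = 0) /\
         (forall M : int, (forall n, n < M -> Y u n v = 0) ->
            forall m p : int, lhs_coef Y YW u v k w M m p = rhs_coef YW u v k w N m p))].

Definition calL_module (F : fieldType) (M : lmodType F) (l1 l2 l3 : F)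
  (L I : int -> M -> M) : Prop :=
  [/\ (forall n, lin_op (L n)), (forall n, lin_op (I n)),
   (forall (m n : int) (w : M),
      L m (L n w) - L n (L m w) =
      (m - n)%:~R *: L (m + n) w
      + (if m + n == 0 then (m * m * m - m)%:~R / 12%:R * l1 else 0) *: w),
   (forall (m n : int) (w : M),
      L m (I n w) - I n (L m w) =
      - (n%:~R *: I (m + n) w)
      - (if m + n == 0 then (m * m + m)%:~R * l2 else 0) *: w)
 & (forall (m n : int) (w : M),
      I m (I n w) - I n (I m w) = (if m + n == 0 then m%:~R * l3 else 0) *: w)].

Definition restricted (F : fieldType) (M : lmodType F) (L I : int -> M -> M) : Prop :=
  forall w : M, exists N : int, forall n : int, N < n -> L n w = 0 /\ I n w = 0.

(* Main.v *)
Require Import Defs.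
From HB Require Import structures.
From mathcomp Require Import all_boot all_order all_algebra.
From mathcomp Require Import zify ring.
Import Order.TTheory GRing.Theory Num.Theory.
Local Open Scope ring_scope.

Set Implicit Arguments.
Unset Strict Implicit.
Unset Printing Implicit Defensive.

(** The theorem reduces to the commutator formula
      [Y_W(u)_a, Y_W(v)_b] = sum_j (-a)^j / j! Y_W(u_j v)_(a+b)
    (exponent indexing) for an arbitrary phi-coordinated module, applied to the
    products u_j v read off from the brackets of the vacuum module.

    Fix w and the total degree m = a + b, and regard the coefficients
    f(a) = Y_W(u)_a Y_W(v)_b w and g(a) = Y_W(v)_b Y_W(u)_a w as sequences in a.
    Multiplication by x1 - x2 is the difference operator, so weak associativity
    says that the k-th difference of f has finite support and that its moments
    are the coefficients of (e^z - 1)^k P(z), where P(z) is the coefficient of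
    x^m in Y_W(Y(u,z)v, x)w.  In dual form: for every polynomial Q the sum of
    Q^(K)(b) (D^k f)(b) is the residue pairing of P with the k-th difference of Q.
    Skew symmetry Y(u,z)v = e^(zD) Y(v,-z)u, with D acting as x d/dx, gives the
    same statement for g.  As a finitely supported sequence is determined by its
    moments in characteristic 0, the k-th differences of f and g agree, so f - g
    is determined by its values at a << 0, where g vanishes and f is given by
    summing its k-th difference against binomial coefficients.  The resulting
    residue is evaluated by [iter_dif_antideriv_binomial]. *)

(** Binomial expansion of [(E - 1)^k] for a shift [E], stated for an abstract array so that it
    serves both polynomials under translation and sequences under an index shift. *)
Lemma iter_diff_binomial (F : fieldType) (M : lmodType F) (h : nat -> nat -> M) :
  (forall k i, h k.+1 i = h k i.+1 - h k i) ->
  forall k i, h k i =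
    \sum_(l < k.+1) ('C(k, l)%:R * (-1) ^+ (k - l)) *: h 0%N (i + l)%N.
Proof.
move=> hS; elim=> [|k IH] i.
  by rewrite big_ord1 bin0 subnn expr0 mulr1 scale1r addn0.
rewrite hS !IH [RHS]big_ord_recl /=.
under [in RHS]eq_bigr => l _ do rewrite /bump leq0n add1n binS natrD mulrDl
  scalerDl subSS addnS -addSn.
rewrite big_split /= addrA [RHS]addrC; congr (_ + _).
rewrite -sumrN [LHS]big_ord_recl [in RHS]big_ord_recr /= (bin_small (ltnSn k)).
rewrite mul0r scale0r addr0 -scaleNr !bin0 !mul1r !subn0 exprS mulN1r.
congr (_ + _); apply: eq_bigr => l _; rewrite /bump leq0n add1n addSnnS.
have -> : (k - l = (k - l.+1).+1)%N by have := ltn_ord l; lia.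
by rewrite exprS mulN1r mulrN scaleNr.
Qed.

(** * Difference calculus on polynomials *)

Section FiniteDifference.
Variable F : fieldType.
Implicit Types (p q : {poly F}) (c : F).

Definition shift_poly c p := p \Po ('X + c%:P).

Fact shift_poly_is_linear c : linear (shift_poly c).
Proof. by move=> a p q; rewrite /shift_poly linearP. Qed.

HB.instance Definition _ c :=
  GRing.isLinear.Build F {poly F} {poly F} _ (shift_poly c) (shift_poly_is_linear c).

Definition dif p := shift_poly 1 p - p.

Fact dif_is_linear : linear dif.
Proof. by move=> a p q; rewrite /dif linearP scalerBr addrACA -opprD. Qed.

HB.instance Definition _ :=
  GRing.isLinear.Build F {poly F} {poly F} _ dif dif_is_linear.

Fact iter_dif_is_linear k : linear (iter k dif).
Proof. by elim: k => // k IH a p q; rewrite !iterS IH linearP. Qed.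

HB.instance Definition _ k :=
  GRing.isLinear.Build F {poly F} {poly F} _ (iter k dif) (iter_dif_is_linear k).

Lemma iter_difB k p q : iter k dif (p - q) = iter k dif p - iter k dif q.
Proof. exact: linearB. Qed.

Lemma iter_difZ k c p : iter k dif (c *: p) = c *: iter k dif p.
Proof. exact: linearZ. Qed.

Lemma shift_polyD c d p : shift_poly c (shift_poly d p) = shift_poly (c + d) p.
Proof.
by rewrite /shift_poly -comp_polyA comp_polyD comp_polyX comp_polyC polyCD addrA.
Qed.

Lemma horner_shift c p x : (shift_poly c p).[x] = p.[x + c].
Proof. by rewrite horner_comp !hornerE. Qed.

Lemma shift_polyM c p q : shift_poly c (p * q) = shift_poly c p * shift_poly c q.
Proof. exact: comp_polyM. Qed.

Lemma shift_polyX c : shift_poly c 'X = 'X + c%:P.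
Proof. exact: comp_polyX. Qed.

Lemma difX : dif 'X = 1.
Proof. by rewrite /dif shift_polyX polyC1 addrC addKr. Qed.

Lemma difC c : dif c%:P = 0.
Proof. by rewrite /dif /shift_poly comp_polyC subrr. Qed.

Lemma shift_iter_dif c k p : shift_poly c (iter k dif p) = iter k dif (shift_poly c p).
Proof.
elim: k => // k IH; rewrite !iterS -IH /dif linearB /= !shift_polyD.
by rewrite (addrC c).
Qed.

Lemma deriv_shift c p : (shift_poly c p)^`() = shift_poly c p^`().
Proof. by rewrite deriv_comp derivD derivX derivC addr0 mulr1. Qed.

Lemma derivn_shift c n p : (shift_poly c p)^`(n) = shift_poly c p^`(n).
Proof. by elim: n => // n IH; rewrite !derivnS IH deriv_shift. Qed.

Lemma derivn_iter_dif n k p : (iter k dif p)^`(n) = iter k dif p^`(n).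
Proof.
by elim: k => // k IH; rewrite !iterS -IH /dif linearB /= derivn_shift.
Qed.

Lemma iter_dif_binomial k p : iter k dif p =
  \sum_(l < k.+1) ('C(k, l)%:R * (-1) ^+ (k - l)) *: shift_poly l%:R p.
Proof.
pose h k i := shift_poly i%:R (iter k dif p).
have h0 : h k 0%N = iter k dif p.
  by rewrite /h /shift_poly addr0 comp_polyXr.
rewrite -h0 (@iter_diff_binomial _ _ h) // => l i.
by rewrite /h iterS /dif linearB /= shift_polyD -natr1.
Qed.

(** Leibniz rule for differences: as [dif 'X = 1], a single correction term appears. *)
Lemma iter_dif_mulX k p : iter k.+1 dif ('X * p) =
  'X * iter k.+1 dif p + k.+1%:R *: shift_poly 1 (iter k dif p).
Proof.
elim: k => [|k IH].
  by rewrite /= /dif shift_polyM shift_polyX scale1r polyC1; ring.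
rewrite iterS IH linearD linearZ /= -!iterS {1}/dif shift_polyM shift_polyX.
rewrite polyC1 -[in RHS]natr1 scalerDl scale1r.
rewrite -[dif (shift_poly _ _)]/(iter 1 dif _) -shift_iter_dif /= /dif.
by rewrite -!mul_polyC; ring.
Qed.

Hypothesis F0 : [pchar F] =i pred0.

Lemma natf_eq0 n : (n%:R == 0 :> F) = (n == 0%N).
Proof. by move: n; apply/pcharf0P. Qed.

Lemma factf_neq0 n : n`!%:R != 0 :> F.
Proof. by rewrite natf_eq0 -lt0n fact_gt0. Qed.

Lemma derivn_eq0_size n p : p^`(n) = 0 -> (size p <= n)%N.
Proof.
move=> p0; apply/leq_sizeP => j lenj.
have := coef_derivn n p (j - n); rewrite p0 coef0 subnKC // => /esym/eqP.
by rewrite -mulr_natr mulf_eq0 natf_eq0 -leqn0 leqNgt ffact_gt0 lenj orbF => /eqP.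
Qed.

Lemma derivn_surj n q : exists p, p^`(n) = q.
Proof.
elim: n q => [|n IH] q; first by exists q.
(* Termwise antiderivative; at [i = 0] the quotient by zero is zero, which fixes the constant
   term. *)
have [p def_p] := IH (\poly_(i < (size q).+1) (q`_i.-1 / i%:R)).
exists p; rewrite derivnS def_p; apply/polyP => i.
rewrite coef_deriv coef_poly ltnS /=.
case: ltnP => [_|le_q]; last by rewrite mul0rn nth_default.
by rewrite -[LHS]mulr_natr divfK // natf_eq0.
Qed.

(** Each difference lowers the size bound by one: if the [k]-th derivative of [p] is constant, that
    of [dif p] is zero, because [dif] commutes with derivation. *)
Lemma iter_dif_eq0 k p : (size p <= k)%N -> iter k dif p = 0.
Proof.
elim: k p => [|k IH] p; first by rewrite size_poly_leq0 => /eqP.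
move=> szp; rewrite iterSr IH //; apply: derivn_eq0_size.
have szd : (size p^`(k) <= 1)%N.
  apply/leq_sizeP => i i_gt0; rewrite coef_derivn nth_default ?mul0rn //.
  by rewrite (leq_trans szp) // -addn1 leq_add2l.
rewrite -[dif p]/(iter 1 dif p) derivn_iter_dif /= (size1_polyC szd).
exact: difC.
Qed.

(** Integrating a solution for the derivative of [q] leaves a constant error, which a multiple of
    ['X] absorbs. *)
Lemma dif_surj q : exists p, dif p = q.
Proof.
elim: {q}(size q) {-2}q (leqnn (size q)) => [|n IH] q szq.
  by exists 0; rewrite linear0; apply/esym/eqP; rewrite -size_poly_leq0.
have [p' def_p'] : exists p, dif p = q^`().
  have [->|q0] := eqVneq q 0; first by exists 0; rewrite linear0 raddf0.
  by apply: IH; have := lt_size_deriv q0; lia.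
have [p def_p] := derivn_surj 1 p'.
have /derivn_eq0_size szr : (q - dif p)^`(1) = 0.
  by rewrite derivnB -[dif p]/(iter 1 dif p) derivn_iter_dif def_p /= def_p' subrr.
exists (p + (q - dif p)`_0 *: 'X); rewrite linearD linearZ /= difX.
rewrite alg_polyC -(size1_polyC szr).
by rewrite addrC subrK.
Qed.

Lemma iter_dif_surj k q : exists p, iter k dif p = q.
Proof.
elim: k q => [|k IH] q; first by exists q.
by have [p <-] := dif_surj q; have [r <-] := IH p; exists r.
Qed.

(* The polynomial binom(X - 1, n). *)
Definition binomial_poly n : {poly F} :=
  n`!%:R^-1 *: \prod_(i < n) ('X - i.+1%:R%:P).

(** Absorption identity of binomial coefficients. It yields Pascal's rule below and the Euler
    equation in [iter_dif_antideriv_binomial]. *)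
Lemma mulX_binomial_poly n :
  'X * binomial_poly n = n.+1%:R *: shift_poly 1 (binomial_poly n.+1).
Proof.
rewrite /binomial_poly linearZ /= scalerA factS natrM invfM mulVKf ?natf_eq0 //.
rewrite -scalerAr; congr (_ *: _).
rewrite big_ord_recl shift_polyM {1}/shift_poly comp_polyB comp_polyX comp_polyC.
rewrite polyC1 addrK; congr (_ * _).
rewrite /shift_poly rmorph_prod /=; apply: eq_bigr => i _.
rewrite comp_polyB comp_polyX comp_polyC /bump leq0n add1n -[i.+2%:R]natr1 polyCD.
by rewrite opprD [- _ - _]addrC addrA addrK.
Qed.

Lemma dif_binomial_poly n : dif (binomial_poly n.+1) = binomial_poly n.
Proof.
have n0 : n.+1%:R != 0 :> F by rewrite natf_eq0.
apply: (scalerI n0); rewrite /dif scalerBr -mulX_binomial_poly.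
rewrite {2}/binomial_poly big_ord_recr /= scalerA factS natrM invfM mulVKf //.
rewrite scalerAl -/(binomial_poly n) mulrC -mulrBr opprB addrC subrK.
by rewrite mulrC mul_polyC.
Qed.

Lemma iter_dif_binomial_poly n : iter n dif (binomial_poly n) = 1.
Proof.
elim: n => [|n IH]; last by rewrite iterSr dif_binomial_poly.
by rewrite /binomial_poly big_ord0 fact0 invr1 scale1r.
Qed.

Lemma horner_binomial_poly n t : (binomial_poly n).[t.+1%:R] = 'C(t, n)%:R.
Proof.
elim: n t => [|n IH] t.
  by rewrite /binomial_poly big_ord0 fact0 invr1 scale1r hornerC bin0.
elim: t => [|t IHt].
  rewrite /binomial_poly hornerZ horner_prod big_ord_recl hornerXsubC.
  by rewrite subrr mul0r mulr0 bin0n.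
have := congr1 (fun p => p.[t.+1%:R]) (dif_binomial_poly n).
rewrite /dif hornerD hornerN horner_shift natr1 IHt IH binS natrD => <-.
by rewrite addrC subrK.
Qed.

(* The operators X and d/dX turn the statement for j into the Euler equation
   [j * s = X * s'] for [s = iter n.+1 dif S], which makes [s] a monomial.  This
   replaces the change of variables x = e^z in the residue computation. *)
Lemma iter_dif_antideriv_binomial n j S : (j <= n)%N ->
  S^`(j.+1) = binomial_poly n -> iter n.+1 dif S = j`!%:R^-1 *: 'X^j.
Proof.
elim: j S => [|j IH] S lejn dS.
  have /derivn_eq0_size szr : (iter n dif S - 'X)^`(1) = 0.
    by rewrite derivnB derivn_iter_dif dS iter_dif_binomial_poly derivn1 derivX subrr.
  rewrite iterS -[iter n dif S](subrK 'X) linearD /= (size1_polyC szr).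
  by rewrite difX difC add0r invr1 scale1r.
have dS' : (S^`())^`(j.+1) = binomial_poly n by rewrite -dS /derivn -iterSr.
have sU := IH _ (ltnW lejn) dS'.
(* [Z] will cancel the Leibniz correction: [dif Z] and the derivative of [S] differ by a polynomial
   of size at most [j.+1 <= n], which [n] differences kill. *)
have [Z dZ] := derivn_surj j.+1 (binomial_poly n.+1).
have j0 : j.+1%:R != 0 :> F by rewrite natf_eq0.
have /derivn_eq0_size szZ : (dif Z - S^`())^`(j.+1) = 0.
  by rewrite derivnB -[dif Z]/(iter 1 dif Z) derivn_iter_dif dZ dS' /=
    dif_binomial_poly subrr.
have difZ : iter n.+1 dif Z = iter n dif S^`().
  by apply/eqP; rewrite -subr_eq0 iterSr -linearB /= iter_dif_eq0 ?(leq_trans szZ).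
have /derivn_eq0_size szE :
    ('X * S^`() - j.+1%:R *: S - n.+1%:R *: shift_poly 1 Z)^`(j.+1) = 0.
  rewrite !derivnB !derivnZ derivn_shift dZ -mulX_binomial_poly.
  have := derivnMXaddC j S^`() 0; rewrite addr0 mulrC => ->.
  rewrite dS' -scaler_nat {1}/derivn -iterSr mulrC addrAC addrK.
  exact: subrr.
have : iter n.+1 dif ('X * S^`() - j.+1%:R *: S - n.+1%:R *: shift_poly 1 Z) = 0.
  by rewrite iter_dif_eq0 // (leq_trans szE) // ltnW.
rewrite !iter_difB !iter_difZ -shift_iter_dif iter_dif_mulX difZ.
rewrite addrAC addrK sU => /eqP; rewrite subr_eq0 => /eqP eS.
apply: (scalerI j0); rewrite -eS -scalerAr -exprS scalerA factS natrM invfM.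
by rewrite mulVKf.
Qed.

End FiniteDifference.

(** * Sequences of fixed total degree: differences, summation, moments *)

Section Sequences.
Variables (F : fieldType) (W : lmodType F).
Implicit Types (h A B : int -> W) (q Q : {poly F}) (N a : int) (T : nat).

(* Multiplication by x1 - x2, read off on the coefficients of fixed total degree
   indexed by the exponent of x1. *)
Definition sdif h : int -> W := fun a => h (a - 1) - h a.

Lemma eq_iter_sdif k h h' : h =1 h' -> iter k sdif h =1 iter k sdif h'.
Proof. by move=> eh; elim: k => // k IH a; rewrite !iterS /sdif !IH. Qed.

Lemma iter_sdifB k h h' :
  iter k sdif (fun a => h a - h' a) =1 (fun a => iter k sdif h a - iter k sdif h' a).
Proof.
by elim: k => // k IH a; rewrite !iterS /sdif !IH opprD addrACA -opprD.
Qed.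

Lemma iter_sdif_sum k n (h : nat -> int -> W) a :
  iter k sdif (fun c => \sum_(j < n) h j c) a = \sum_(j < n) iter k sdif (h j) a.
Proof. by elim: k a => // k IH a; rewrite iterS /sdif !IH -sumrB. Qed.

Lemma iter_sdif_binomial k h a : iter k sdif h a =
  \sum_(l < k.+1) ('C(k, l)%:R * (-1) ^+ (k - l)) *: h (a - l%:Z).
Proof.
pose d k i := iter k sdif h (a - i%:Z).
have -> : iter k sdif h a = d k 0%N by rewrite /d subr0.
rewrite (@iter_diff_binomial _ _ d) // => l i.
by rewrite /d iterS /sdif; congr (iter l sdif h _ - _); lia.
Qed.

Lemma iter_sdif_eq0_above k h R c :
  (forall a, R <= a -> h a = 0) -> R + k%:Z <= c -> iter k sdif h c = 0.
Proof.
move=> h0; elim: k c => [|k IH] c leRc; first by apply: h0; lia.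
by rewrite iterS /sdif !IH ?subrr //; lia.
Qed.

Lemma sum_bin_sdif k T B a :
  \sum_(t < T) 'C(t, k.+1)%:R *: sdif B (a + 1 + t%:Z) =
  \sum_(t < T) 'C(t, k)%:R *: B (a + 1 + t%:Z) - 'C(T, k.+1)%:R *: B (a + T%:Z).
Proof.
elim: T => [|T IH]; first by rewrite !big_ord0 bin0n scale0r subr0.
rewrite !big_ord_recr /= IH /sdif.
have -> : a + 1 + T%:Z - 1 = a + T%:Z by lia.
have -> : a + 1 + T%:Z = a + T.+1%:Z by lia.
by rewrite binS natrD scalerDl scalerBr addrA subrK opprD [- _ - _]addrC !addrA addrK.
Qed.

(** Division by [(x1 - x2)^(k+1)], expanded in powers of [x2 / x1], which makes sense because [h]
    vanishes far up. The boundary terms of [sum_bin_sdif] fall where the differences of [h] are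
    zero. *)
Lemma iter_sdif_inv k h R a T :
  (forall c, R <= c -> h c = 0) -> R + k%:Z <= a + T%:Z ->
  h a = \sum_(t < T) 'C(t, k)%:R *: iter k.+1 sdif h (a + 1 + t%:Z).
Proof.
move=> h0; elim: k => [|k IH] le_RT.
  have -> : \sum_(t < T) 'C(t, 0)%:R *: iter 1 sdif h (a + 1 + t%:Z) = h a - h (a + T%:Z).
    elim: T {le_RT} => [|T IH]; first by rewrite big_ord0 addr0 subrr.
    rewrite big_ord_recr /= IH bin0 scale1r /sdif addrA.
    have -> : a + 1 + T%:Z - 1 = a + T%:Z by lia.
    have -> : a + 1 + T%:Z = a + T.+1%:Z by lia.
    by rewrite subrK.
  by rewrite [h (a + _)]h0 ?subr0 //; lia.
rewrite iterS sum_bin_sdif -IH; last by lia.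
by rewrite (iter_sdif_eq0_above h0) ?scaler0 ?subr0 //; lia.
Qed.

Lemma iter_sdif_eq0 k h N :
  (forall a, iter k sdif h a = 0) -> (forall a, a < N -> h a = 0) ->
  forall a, h a = 0.
Proof.
elim: k h => // k IH h dh0 h0.
have {dh0} dh : forall a, sdif h a = 0.
  by apply: IH => a; [rewrite -iterSr dh0 | move=> ltaN; rewrite /sdif !h0 ?subrr //; lia].
have hB n a : h a = h (a - n%:Z).
  elim: n => [|n ->]; first by rewrite subr0.
  have /eqP := dh (a - n%:Z); rewrite /sdif subr_eq0 => /eqP <-.
  by congr h; lia.
by move=> a; rewrite (hB (absz (a - N)%R).+1) h0 //; lia.
Qed.

(** The evaluation point is [- a] because [sdif] shifts the index down while [dif] shifts the
    variable up. *)
Lemma iter_sdif_horner k q (x : W) a :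
  iter k sdif (fun c => q.[(- c)%:~R] *: x) a = (iter k (@dif F) q).[(- a)%:~R] *: x.
Proof.
elim: k a => // k IH a; rewrite !iterS /sdif !IH -scalerBl; congr (_ *: _).
by rewrite /dif hornerD hornerN horner_shift opprB addrC rmorphD /= addrC [_ + 1]addrC.
Qed.

Definition supported A N T := forall a, (a < N) || (N + T%:Z <= a) -> A a = 0.

(** The [q]-moment of [A]. The window keeps the sum finite; by [pairing_indep] any window containing
    the support gives the same value. *)
Definition pairing N T q A : W :=
  \sum_(t < T) q.[(N + t%:Z)%:~R] *: A (N + t%:Z).

Lemma pairing_widen d e A N T q : supported A N T ->
  pairing (N - d%:Z) (d + T + e)%N q A = pairing N T q A.
Proof.
move=> A0; rewrite /pairing -addnA big_split_ord /= big1 ?add0r; last first.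
  by move=> t _; rewrite A0 ?scaler0 //; have := ltn_ord t; lia.
rewrite big_split_ord /= [X in _ + X]big1 ?addr0; last first.
  by move=> t _; rewrite A0 ?scaler0 //; lia.
by apply: eq_bigr => t _; have -> : N - d%:Z + (d + t)%N%:Z = N + t%:Z by lia.
Qed.

Lemma pairing_indep A N T N' T' q : supported A N T -> supported A N' T' ->
  pairing N T q A = pairing N' T' q A.
Proof.
move=> s s'.
pose m : int := Order.min N N'.
pose M : int := Order.max (N + T%:Z) (N' + T'%:Z).
rewrite -(pairing_widen (absz (N - m)%R) (absz (M - N - T%:Z)%R) q s).
rewrite -(pairing_widen (absz (N' - m)%R) (absz (M - N' - T'%:Z)%R) q s').
by congr pairing; rewrite /m /M; lia.
Qed.

Lemma supported_sdif A N T : supported A N T -> supported (sdif A) N T.+1.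
Proof. by move=> A0 a ha; rewrite /sdif !A0 ?subrr //; lia. Qed.

(** Summation by parts: moving the index shift from [A] to [q] makes [sdif] and [dif] adjoint; the
    boundary terms lie outside the support. *)
Lemma pairing_sdif A N T q : supported A N T ->
  pairing N T.+1 q (sdif A) = pairing N T (dif q) A.
Proof.
move=> A0; rewrite /pairing /sdif.
under eq_bigr do rewrite scalerBr.
rewrite sumrB big_ord_recl [X in _ - X]big_ord_recr /= !A0 ?scaler0; try lia.
rewrite add0r addr0 -sumrB; apply: eq_bigr => t _.
rewrite /dif hornerD hornerN horner_shift scalerBl /bump leq0n; congr (_ *: A _ - _).
  by congr (q.[_]); rewrite -[1]/(1%:~R) -rmorphD /=; congr (_%:~R); lia.
by lia.
Qed.

Lemma iter_pairing_sdif k A N T q : supported A N T ->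
  supported (iter k sdif A) N (k + T) /\
  pairing N (k + T) q (iter k sdif A) = pairing N T (iter k (@dif F) q) A.
Proof.
move=> A0; elim: k q => [|k IH] q //; have [sA _] := IH q.
split; first exact: supported_sdif.
by rewrite addSn iterS pairing_sdif // (IH _).2 -iterSr.
Qed.

Lemma pairingB A B N T q :
  pairing N T q (fun a => A a - B a) = pairing N T q A - pairing N T q B.
Proof. by rewrite /pairing -sumrB; apply: eq_bigr => t _; rewrite scalerBr. Qed.

Lemma pairing_linear N T A : lin_op (fun q : {poly F} => pairing N T q A).
Proof.
move=> c p q; rewrite /pairing scaler_sumr -big_split; apply: eq_bigr => t _ /=.
by rewrite hornerD hornerZ scalerDl scalerA.
Qed.

Lemma pairing_eq0 A N T : [pchar F] =i pred0 -> supported A N T ->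
  (forall q, pairing N T q A = 0) -> forall a, A a = 0.
Proof.
move=> F0 sA pA0 a; have [out|] := boolP ((a < N) || (N + T%:Z <= a)); first exact: sA.
move=> ina; have ltt : (absz (a - N)%R < T)%N by lia.
pose t0 := Ordinal ltt; have -> : a = N + t0%:Z by rewrite /=; lia.
(* A Lagrange polynomial: it vanishes at the other points of the window, and its value at [a] is a
   product of nonzero integers, nonzero in characteristic 0. *)
have := pA0 (\prod_(t < T | t != t0) ('X - (N + t%:Z)%:~R%:P)).
rewrite /pairing (bigD1 t0) //= [X in _ + X]big1 ?addr0; last first.
  move=> t tt0; rewrite horner_prod (bigD1 t) //= hornerXsubC subrr mul0r.
  exact: scale0r.
move=> /eqP; rewrite scaler_eq0 horner_prod prodf_seq_eq0 => /orP[|/eqP //].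
case/hasP => t _ /andP[tt0]; rewrite hornerXsubC -rmorphB /=.
have [le|lt] := leqP t t0.
  have -> : N + t0%:Z - (N + t%:Z) = (t0 - t)%N%:Z by lia.
  by rewrite -[_%:~R]/(_%:R) natf_eq0 // => e0; case/eqP: tt0; apply: ord_inj; lia.
have -> : N + t0%:Z - (N + t%:Z) = - (t - t0)%N%:Z by lia.
by rewrite mulrNz oppr_eq0 -[_%:~R]/(_%:R) natf_eq0 // => e0; lia.
Qed.

(** * Sequences represented by a series in [z] *)

Section Representation.
Variables (K : nat) (P : int -> W).

(* The residue pairing of [Q] with [z^K * sum_n P n z^n]. *)
Definition psi Q : W := \sum_(i < size Q) (Q`_i * i`!%:R) *: P (i%:Z - K%:Z).

Lemma psiE n Q : (size Q <= n)%N ->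
  psi Q = \sum_(i < n) (Q`_i * i`!%:R) *: P (i%:Z - K%:Z).
Proof.
move=> szQ; rewrite -(subnKC szQ) big_split_ord /= [X in _ + X]big1 ?addr0 //.
by move=> i _; rewrite nth_default ?leq_addr // mul0r scale0r.
Qed.

Fact psi_is_linear : linear psi.
Proof.
move=> c p q; pose n := maxn (size p) (size q).
have szc : (size (c *: p + q)%R <= n)%N.
  rewrite (leq_trans (size_polyD _ _)) // geq_max leq_maxr andbT.
  by rewrite (leq_trans (size_scale_leq _ _)) // leq_maxl.
rewrite (psiE szc) (psiE (leq_maxl _ _ : (_ <= n)%N)) (psiE (leq_maxr _ _ : (_ <= n)%N)).
rewrite scaler_sumr -big_split; apply: eq_bigr => i _ /=.
by rewrite coefD coefZ mulrDl scalerDl scalerA mulrA.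
Qed.

HB.instance Definition _ := GRing.isLinear.Build F {poly F} W _ psi psi_is_linear.

Lemma psiXn n : psi 'X^n = n`!%:R *: P (n%:Z - K%:Z).
Proof.
rewrite (@psiE n.+1) ?size_polyXn // big_ord_recr /= big1 ?add0r => [|i _].
  by rewrite coefXn eqxx mul1r.
by rewrite coefXn ltn_eqF // mul0r scale0r.
Qed.

Hypothesis F0 : [pchar F] =i pred0.

Lemma bin_fact_div n l : (l <= n)%N -> 'C(n, l)%:R * (n - l)`!%:R = n`!%:R / l`!%:R :> F.
Proof.
move=> ln; apply: (mulIf (factf_neq0 F0 l)).
by rewrite divfK ?factf_neq0 // -!natrM -(bin_fact ln) -mulnA [((n - l)`! * _)%N]mulnC.
Qed.

(** Translation by [c] is dual to multiplication by [e^(cz)]: the sum is the coefficient of [z^n] in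
    [e^(cz)] times the power series part of [z^K P(z)]. *)
Lemma psi_shiftXn c n : psi (shift_poly c 'X^n) =
  n`!%:R *: \sum_(l < n.+1) (c ^+ l / l`!%:R) *: P (n%:Z - l%:Z - K%:Z).
Proof.
rewrite /shift_poly comp_Xn_poly exprDn linear_sum scaler_sumr /=.
apply: eq_bigr => l _; have ln : (l <= n)%N by rewrite -ltnS.
rewrite -polyC_exp mulrC mul_polyC linearMn linearZ /= psiXn -scaler_nat !scalerA.
congr (_ *: P _); last by lia.
by rewrite mulrAC bin_fact_div // mulrAC mulrA.
Qed.

(* Dual form of [sum_b (iter k sdif h b) e^(b z) = (e^z - 1)^k * sum_n P n z^n]. *)
Definition represents k h :=
  (exists N T, supported (iter k sdif h) N T) /\
  (forall N T, supported (iter k sdif h) N T -> forall Q,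
     pairing N T Q^`(K) (iter k sdif h) = psi (iter k (@dif F) Q)).

(** Both sides get multiplied by [e^z - 1]; this brings two expansions to a common exponent. *)
Lemma representsS k h : represents k h -> represents k.+1 h.
Proof.
case=> [[N [T sh]] rh]; split; first by exists N, T.+1; apply: supported_sdif.
move=> N' T' sh' Q; rewrite (pairing_indep _ sh' (supported_sdif sh)).
rewrite iterS pairing_sdif // -[dif Q^`(K)]/(iter 1 (@dif F) _) -derivn_iter_dif.
by rewrite rh // -iterSr.
Qed.

Lemma representsD l k h : represents k h -> represents (l + k) h.
Proof. by move=> rh; elim: l => // l; apply: representsS. Qed.

Lemma represents_inj k f g : represents k f -> represents k g ->
  iter k sdif f =1 iter k sdif g.
Proof.
move=> [[N [T sf]] rf] [[N' [T' sg]] rg] a; apply/eqP; rewrite -subr_eq0; apply/eqP.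
pose m : int := Order.min N N'.
pose M : int := Order.max (N + T%:Z) (N' + T'%:Z).
pose R := absz (M - m)%R.
have sf' : supported (iter k sdif f) m R.
  by move=> c hc; apply: sf; move: hc; rewrite /R /m /M; lia.
have sg' : supported (iter k sdif g) m R.
  by move=> c hc; apply: sg; move: hc; rewrite /R /m /M; lia.
move: a; apply: (@pairing_eq0 _ m R F0).
  by move=> c hc; rewrite sf' // sg' // subrr.
move=> q; have [Q <-] := derivn_surj F0 K q.
by rewrite pairingB rf // rg // subrr.
Qed.

End Representation.

Lemma represents_low_coef K P k f R : [pchar F] =i pred0 -> (K <= k)%N ->
  represents K.+1 P k.+1 f -> (forall a, R <= a -> f a = 0) ->
  exists N, forall a, a < N ->
    f a = \sum_(j < K.+1) ((- a)%:~R ^+ j / j`!%:R) *: P (- j%:Z - 1).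
Proof.
move=> F0 leKk [[N [T sf]] rf] f0; exists N => a ltaN.
(* Moments are known only against derivatives of order [K.+1], so the summation weight is written as
   one. *)
have [S dS] := derivn_surj F0 K.+1 (binomial_poly F k).
pose X : int := Order.max (R + k%:Z) (N + T%:Z).
pose T0 := absz (X - a)%R.
rewrite (@iter_sdif_inv k f R a T0) //; last by rewrite /T0 /X; lia.
(* The weight is [binomial_poly k] at [t.+1 = (a + 1 + t) - a], whence the translation by [- a]. The
   window from [a + 1] contains the support because [a < N]. *)
have -> : \sum_(t < T0) 'C(t, k)%:R *: iter k.+1 sdif f (a + 1 + t%:Z) =
    pairing (a + 1) T0 (shift_poly (- a)%:~R S)^`(K.+1) (iter k.+1 sdif f).
  apply: eq_bigr => t _; congr (_ *: _); rewrite derivn_shift dS horner_shift.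
  rewrite -rmorphD /= -horner_binomial_poly //; congr (_.[_]).
  by rewrite -[LHS]/(t.+1%:Z%:~R); congr (_%:~R); lia.
rewrite rf; last first.
  by move=> c hc; apply: sf; move: hc; rewrite /T0 /X; lia.
rewrite -shift_iter_dif (iter_dif_antideriv_binomial F0 leKk dS) !linearZ /=.
rewrite psi_shiftXn // scalerA mulVf ?factf_neq0 // scale1r.
by apply: eq_bigr => j _; congr (_ *: P _); lia.
Qed.

(** The right side [c] is a polynomial in [a] of degree at most [K <= k], so [k.+1] differences kill
    it. They agree on [f] and [g], and [f - g - c] vanishes far down, hence everywhere. *)
Lemma represents_commutator K P k f g R R' : [pchar F] =i pred0 -> (K <= k)%N ->
  represents K.+1 P k.+1 f -> represents K.+1 P k.+1 g ->
  (forall a, R <= a -> f a = 0) -> (forall a, a < R' -> g a = 0) ->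
  forall a, f a - g a = \sum_(j < K.+1) ((- a)%:~R ^+ j / j`!%:R) *: P (- j%:Z - 1).
Proof.
move=> F0 leKk rf rg f0 g0 a; have [N fN] := represents_low_coef F0 leKk rf f0.
pose c a := \sum_(j < K.+1) (j`!%:R^-1 *: 'X^j).[(- a)%:~R] *: P (- j%:Z - 1).
have cE b : \sum_(j < K.+1) ((- b)%:~R ^+ j / j`!%:R) *: P (- j%:Z - 1) = c b.
  by apply: eq_bigr => j _; rewrite hornerZ hornerXn mulrC.
have dc b : iter k.+1 sdif c b = 0.
  rewrite (iter_sdif_sum _ _ (fun j c => (j`!%:R^-1 *: 'X^j).[(- c)%:~R] *: P (- j%:Z - 1))).
  rewrite big1 // => j _; rewrite iter_sdif_horner iter_dif_eq0 ?horner0 ?scale0r //.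
  rewrite (leq_trans (size_scale_leq _ _)) // size_polyXn.
  by rewrite (leq_trans (ltn_ord j)).
apply/eqP; rewrite cE -subr_eq0; apply/eqP; move: a.
apply: (@iter_sdif_eq0 k.+1 _ (Order.min N R')) => [a|a lta].
  by rewrite !iter_sdifB dc (represents_inj F0 rf rg) subrr subr0.
by rewrite fN ?g0 ?cE ?subr0 ?subrr //; move: lta; lia.
Qed.

End Sequences.

(** * Passage from [lin_op] to bundled linear maps *)

Definition lin_op_linear (F : fieldType) (M N : lmodType F) (f : M -> N)
    (hf : lin_op f) : {linear M -> N} :=
  HB.pack f (GRing.isLinear.Build F M N _ f hf).

Section LinOp.
Variables (F : fieldType) (M N : lmodType F) (f : M -> N) (hf : lin_op f).

Lemma lin_op0 : f 0 = 0.
Proof. exact: (linear0 (lin_op_linear hf)). Qed.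

Lemma lin_opD x y : f (x + y) = f x + f y.
Proof. exact: (linearD (lin_op_linear hf)). Qed.

Lemma lin_opZ c x : f (c *: x) = c *: f x.
Proof. exact: (linearZ_LR (lin_op_linear hf)). Qed.

Lemma lin_op_sum n (x : 'I_n -> M) : f (\sum_(i < n) x i) = \sum_(i < n) f (x i).
Proof. exact: (linear_sum (lin_op_linear hf)). Qed.

End LinOp.

Lemma eq_lin_op_poly (F : fieldType) (M : lmodType F) (f g : {poly F} -> M) :
  lin_op f -> lin_op g -> (forall n, f 'X^n = g 'X^n) -> f =1 g.
Proof.
move=> hf hg eXn p; rewrite -[p]coefK poly_def (lin_op_sum hf) (lin_op_sum hg).
by apply: eq_bigr => i _; rewrite (lin_opZ hf) (lin_opZ hg) eXn.
Qed.

(** * Reversal of the index, exchanging the roles of [x1] and [x2] *)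

Section Reflection.
Variables (F : fieldType).
Implicit Types (c : F) (Q : {poly F}).

Definition reflect_poly c Q := Q \Po (c%:P - 'X).

Fact reflect_poly_is_linear c : linear (reflect_poly c).
Proof. by move=> a p q; rewrite /reflect_poly linearP. Qed.

HB.instance Definition _ c :=
  GRing.isLinear.Build F {poly F} {poly F} _ (reflect_poly c) (reflect_poly_is_linear c).

Lemma horner_reflect c Q x : (reflect_poly c Q).[x] = Q.[c - x].
Proof. by rewrite horner_comp !hornerE. Qed.

Lemma derivn_reflect c n Q :
  (reflect_poly c Q)^`(n) = (-1) ^+ n *: reflect_poly c Q^`(n).
Proof.
elim: n => [|n IH]; first by rewrite scale1r.
rewrite !derivnS IH derivZ deriv_comp derivB derivC derivX sub0r mulrN1 exprS.
by rewrite mulN1r scaleNr scalerN.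
Qed.

(** Reflection turns the step [+1] into [-1], so each difference costs a sign and lowers the
    constant of the reflection by one. *)
Lemma iter_dif_reflect c k Q :
  iter k (@dif F) (reflect_poly (c + k%:R) Q) =
  (-1) ^+ k *: reflect_poly c (iter k (@dif F) Q).
Proof.
elim: k Q => [|k IH] Q; first by rewrite addr0 scale1r.
rewrite !iterSr; have -> : dif (reflect_poly (c + k.+1%:R) Q) =
    - reflect_poly (c + k%:R) (dif Q).
  rewrite /dif linearB /= opprB; congr (_ - _); rewrite /shift_poly /reflect_poly.
    rewrite -comp_polyA comp_polyB comp_polyC comp_polyX -natr1 addrA polyCD.
    by congr (_ \Po _); rewrite opprD addrACA subrr addr0.
  rewrite -comp_polyA comp_polyD comp_polyC comp_polyX -natr1 addrA [in LHS]polyCD.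
  by congr (_ \Po _); rewrite addrAC.
by rewrite linearN /= IH exprS mulN1r scaleNr.
Qed.

Variable W : lmodType F.
Implicit Types (h A : int -> W).

Lemma iter_sdif_reflect k m h a :
  iter k (@sdif F W) (fun b => h (m - b)) a =
  (-1) ^+ k *: iter k (@sdif F W) h (m + k%:Z - a).
Proof.
elim: k a => [|k IH] a; first by rewrite scale1r addr0.
have sdifE b h' : sdif h' b = h' (b - 1) - h' b :> W by [].
rewrite !iterS !sdifE !IH exprS mulN1r scaleNr -scalerBr -scalerN [in RHS]opprB.
by congr (_ *: (iter k _ h _ - iter k _ h _)); lia.
Qed.

Lemma pairing_reflect N T (c : int) q A :
  pairing (c - N - T%:Z + 1) T q (fun a => A (c - a)) =
  pairing N T (reflect_poly c%:~R q) A.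
Proof.
rewrite /pairing (reindex_inj rev_ord_inj); apply: eq_bigr => t _ /=.
rewrite horner_reflect -rmorphB /=; congr (q.[_%:~R] *: A _).
  by have := ltn_ord t; lia.
by have := ltn_ord t; lia.
Qed.

Lemma represents_ext K (P : int -> W) k h h' :
  h =1 h' -> represents K P k h -> represents K P k h'.
Proof.
move=> eh [[N [T sh]] rh]; have E := eq_iter_sdif k eh; split.
  by exists N, T => a ha; rewrite -E sh.
move=> N' T' sh' Q; rewrite -(rh N' T') => [|a ha]; last by rewrite E sh'.
by apply: eq_bigr => t _; rewrite E.
Qed.

(** The signs [(-1)^k] from differencing the reversed sequence and the reflected polynomial cancel;
    the sign [(-1)^K] of the derivatives is the one in the hypothesis. *)
Lemma represents_reflect K (P P' : int -> W) k m h :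
  (forall Q, psi K P Q = (-1) ^+ K *: psi K P' (reflect_poly m%:~R Q)) ->
  represents K P' k h -> represents K P k (fun a => h (m - a)).
Proof.
move=> eP [[N [T sh]] rh].
have sh' : supported (iter k (@sdif F W) (fun a => h (m - a)))
    (m + k%:Z - N - T%:Z + 1) T.
  by move=> a ha; rewrite iter_sdif_reflect sh ?scaler0 //; lia.
split; first by exists (m + k%:Z - N - T%:Z + 1), T.
move=> N' T' sh'' Q; rewrite (pairing_indep _ sh'' sh').
rewrite {1}/pairing; under eq_bigr => t _ do
  rewrite iter_sdif_reflect scalerA mulrC -scalerA.
rewrite -scaler_sumr.
rewrite -/(pairing _ _ _ (fun a => iter k (@sdif F W) h (m + k%:Z - a))).
rewrite pairing_reflect.
have -> : reflect_poly (m + k%:Z)%:~R Q^`(K) =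
    (-1) ^+ K *: (reflect_poly (m%:~R + k%:R) Q)^`(K).
  by rewrite derivn_reflect scalerA -expr2 sqrr_sign scale1r rmorphD.
rewrite (lin_opZ (pairing_linear _ _ _)) rh // iter_dif_reflect [psi _ _ _]linearZ /=.
by rewrite !scalerA mulrCA -expr2 sqrr_sign mulr1 eP.
Qed.

End Reflection.

(** * From weak associativity to the commutator formula *)

Section PhiCoordinated.
Variables (F : fieldType) (V : lmodType F) (Y : V -> int -> V -> V) (vac : V).
Variables (W : lmodType F) (YW : V -> int -> W -> W).
Hypotheses (F0 : [pchar F] =i pred0) (hY : vertex_algebra Y vac).
Hypothesis hW : phi_coordinated_module Y vac YW.

Lemma YW_linl n w : lin_op (fun u => YW u n w). Proof. by case: hW. Qed.
Lemma YW_linr u n : lin_op (YW u n). Proof. by case: hW. Qed.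

Lemma psi_iter_dif_Xn K (P : int -> W) k n :
  psi K P (iter k (@dif F) 'X^n) =
  n`!%:R *: \sum_(l < n.+1) expk_coef F k l *: P (n%:Z - l%:Z - K%:Z).
Proof.
rewrite iter_dif_binomial linear_sum /=.
under eq_bigr => i _ do rewrite linearZ /= psi_shiftXn // scalerA mulrC -scalerA scaler_sumr.
rewrite -scaler_sumr exchange_big /=; congr (_ *: _); apply: eq_bigr => l _.
rewrite /expk_coef mulr_suml scaler_suml.
by apply: eq_bigr => i _; rewrite scalerA mulrA.
Qed.

Lemma iter_sdif_prod_coef u v k w m a :
  iter k (@sdif F W) (fun c => YW u c (YW v (m - c) w)) a =
  prod_coef YW u v k w a (m + k%:Z - a).
Proof.
rewrite iter_sdif_binomial (reindex_inj rev_ord_inj); apply: eq_bigr => i _ /=.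
have lei : (i <= k)%N by rewrite -ltnS.
rewrite subSS bin_sub // subKn //; congr (_ *: YW u _ (YW v _ w)).
by lia.
Qed.

(** By linearity it suffices to test [Q = X^n], where the claim is the coefficient of [z^(n-K)] in
    weak associativity, up to the factor [n!]. *)
Lemma phi_represents u v K m w : (forall n, n < - K%:Z -> Y u n v = 0) ->
  exists k, represents K (fun n => YW (Y u n v) m w) k
    (fun a => YW u a (YW v (m - a) w)).
Proof.
move=> uv0; case: hW => _ _ _ _ /(_ u v)[k /(_ w)[N [pc0 assoc]]]; exists k.
set h := fun a => YW u a (YW v (m - a) w).
pose T := (absz (m + k%:Z - N - N)%R).+1.
have hE := iter_sdif_prod_coef u v k w m; rewrite -/h in hE.
have sh : supported (iter k (@sdif F W) h) N T.
  by move=> a ha; rewrite hE; apply: pc0; move: ha; rewrite /T; lia.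
split; first by exists N, T.
move=> N' T' sh' Q; rewrite (pairing_indep _ sh' sh); move: Q.
apply: eq_lin_op_poly => [c p q|c p q|n]; first by rewrite derivnD derivnZ pairing_linear.
  by rewrite !linearP.
(* The factor [(x1 - x2)^k] raises the total degree from [m] to [m + k]. *)
have {assoc} := assoc (- K%:Z) uv0 (m + k%:Z) (n%:Z - K%:Z).
rewrite /lhs_coef; have -> : (absz (n%:Z - K%:Z - - K%:Z)%R).+1 = n.+1 by lia.
under eq_bigr => l _ do rewrite addrK [n%:Z - K%:Z - l%:Z]addrAC.
rewrite psi_iter_dif_Xn derivnXn => ->; case: (ltnP n K) => [ltnK|leKn].
  rewrite ffact_small // mulr0n (lin_op0 (pairing_linear _ _ _)).
  have -> : n%:Z - K%:Z = Negz (K - n).-1 by lia.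
  by rewrite scaler0.
have -> : n%:Z - K%:Z = (n - K)%N%:Z by lia.
rewrite /rhs_coef -/T scaler_sumr; apply: eq_bigr => t _; rewrite hE scalerA.
rewrite opprD addrA; congr (_ *: _); rewrite hornerMn hornerXn -(ffact_fact leKn).
by rewrite natrM -mulr_natl mulrCA -mulrA divff ?factf_neq0 // mulr1 mulrC.
Qed.

(* [Y a i vac] is [D^i a / i!] for the translation operator [D], so this says that
   [D] acts on the module as [x d/dx]. *)
Lemma YW_translation a i m w :
  YW (Y a i%:Z vac) m w = (m%:~R ^+ i / i`!%:R) *: YW a m w.
Proof.
have a0 n : n < - 0%N%:Z -> Y a n vac = 0.
  by case: hY => _ _ _ [van _] _ n0; apply: van; lia.
have [k [_ rk]] := phi_represents m w a0.
(* As [YW vac] is the identity, [h] lives at [m] alone; choosing [Q] with [k]-th difference [X^i]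
   undoes the factor [(e^z - 1)^k]. *)
set h := (fun b => YW a b _) in rk; have [Q dQ] := iter_dif_surj F0 k 'X^i.
have hvac b : YW vac b w = if b == 0 then w else 0 by case: hW.
have sh : supported h m 1.
  move=> b hb; rewrite /h hvac ifF ?(lin_op0 (YW_linr _ _)) //; lia.
have [sk] := iter_pairing_sdif k Q sh.
rewrite (rk _ _ sk Q) dQ psiXn subr0 /pairing big_ord1 !addr0 hornerXn.
rewrite /h subrr hvac eqxx => eqi.
by rewrite mulrC -scalerA -eqi scalerA mulVf ?factf_neq0 // scale1r.
Qed.

Lemma binzN1 i : binz F (-1) i = (-1) ^+ i.
Proof.
rewrite /binz; have -> : \prod_(j < i) (-1 - (j : nat)%:Z)%:~R = (-1) ^+ i * i`!%:R :> F.
  elim: i => [|i IH]; first by rewrite big_ord0 mulr1.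
  rewrite big_ord_recr /= IH exprS factS natrM.
  have -> : -1 - i%:Z = - i.+1%:Z by lia.
  by rewrite mulrNz -[_%:~R]/(_%:R); ring.
by rewrite mulfK ?factf_neq0.
Qed.

(** Coefficient of [z^n] in [Y(u,z)v = e^(zD) Y(v,-z)u]. *)
Lemma Y_skew u v n B : (0 < B)%N -> (forall i : nat, (B <= i)%N -> Y v (n - i%:Z) u = 0) ->
  Y u n v = (-1) ^+ absz n *: \sum_(i < B) (-1) ^+ i *: Y (Y v (n - i%:Z) u) i%:Z vac.
Proof.
move=> B0 v0; case: hY => [[_ linr] _ _ [van cre] bor].
(* Applied to the vacuum with these exponents, the right side of the Borcherds identity keeps only
   the term with [v_(-1) vac = v], which is [Y u n v] up to sign. *)
have {bor} := bor v u vac (-1) 0 (- n - 1) B; rewrite /mode => bor.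
lapply bor; last first => [i leBi|{bor}].
  split; [rewrite -[RHS](v0 i leBi); congr (Y _ _ _); lia | |].
    by apply: van; lia.
  by apply: van; lia.
case: B B0 {v0} => // B _.
rewrite [RHS]big_ord_recl [X in _ = _ + X]big1 => [|i _]; last first.
  rewrite (van u) ?(van v) ?(lin_op0 (linr _ _)) ?scaler0 ?subr0 ?scaler0 //.
  by rewrite /= /bump; lia.
rewrite /= (van u) // (lin_op0 (linr _ _)) sub0r addr0 /binz big_ord0 fact0.
rewrite divr1 mulr1 scale1r.
rewrite (_ : - (-1 + 0) - 1 = 0 :> int) // cre.
have -> : - (0 + (- n - 1) - 0%:Z) - 1 = n by lia.
have -> : (-1) ^+ absz (- n - 1)%R = - (-1) ^+ absz n :> F.
  rewrite -signr_odd -[in RHS]signr_odd.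
  have -> : odd (absz (- n - 1)%R) = ~~ odd (absz n) by lia.
  by rewrite signrN.
rewrite scaleNr opprK addr0 => /(congr1 (GRing.scale ((-1) ^+ absz n))).
rewrite scalerA -expr2 sqrr_sign scale1r => <-.
congr (_ *: _); apply: eq_bigr => i _; rewrite -/(binz F (-1) i) binzN1.
by congr (_ *: Y (Y v _ u) _ _); lia.
Qed.

(** By [YW_translation], [e^(zD)] acts in degree [m] as [e^(mz)]. Together with [z -> -z] this is
    dual to [X -> m - X]; the sign comes from [z^K]. *)
Lemma psi_skew u v K m w Q :
  (forall n, n < - K%:Z -> Y v n u = 0) ->
  psi K (fun n => YW (Y u n v) m w) Q =
  (-1) ^+ K *: psi K (fun n => YW (Y v n u) m w) (reflect_poly m%:~R Q).
Proof.
move=> v0; move: Q; apply: eq_lin_op_poly => [c p q|c p q|n]; first by rewrite linearP.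
  by rewrite [reflect_poly _ _]linearP [psi _ _ _]linearP scalerDr !scalerA mulrC.
have -> : reflect_poly m%:~R 'X^n = (-1) ^+ n *: shift_poly (- m%:~R) 'X^n :> {poly F}.
  rewrite /reflect_poly /shift_poly !comp_Xn_poly polyCN -opprB [in LHS]exprNn.
  by rewrite -mul_polyC polyC_exp polyCN polyC1.
rewrite linearZ /= psi_shiftXn // psiXn.
rewrite (@Y_skew u v _ n.+1) // => [|i lti]; last by apply: v0; lia.
rewrite (lin_opZ (YW_linl _ _)) (lin_op_sum (YW_linl _ _)) !scalerA.
have -> : n`!%:R * (-1) ^+ absz (n%:Z - K%:Z)%R = (-1) ^+ K * (-1) ^+ n * n`!%:R :> F.
  rewrite mulrC -exprD -signr_odd -[in RHS]signr_odd; congr (_ ^+ nat_of_bool _ * _); lia.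
congr (_ *: _); apply: eq_bigr => l _.
rewrite (lin_opZ (YW_linl _ _)) YW_translation scalerA [in RHS]exprNn.
by rewrite mulrA; congr (_ *: YW (Y v _ u) _ _); lia.
Qed.

(** By [psi_skew], the reversed expansion for [(v, u)] represents the same series as that for
    [(u, v)]. Truncation on [w] makes the two orders vanish at opposite ends. *)
Lemma phi_commutator u v K a b w :
  (forall n, n < - K.+1%:Z -> Y u n v = 0) ->
  (forall n, n < - K.+1%:Z -> Y v n u = 0) ->
  YW u a (YW v b w) - YW v b (YW u a w) =
  \sum_(j < K.+1) ((- a)%:~R ^+ j / j`!%:R) *: YW (Y u (- j%:Z - 1) v) (a + b) w.
Proof.
move=> uv0 vu0; pose m := a + b.
have [k1 r1] := phi_represents m w uv0; have [k2 r2] := phi_represents m w vu0.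
have {}r2 := represents_reflect (fun Q => psi_skew m w Q vu0) r2.
have e2 c : YW v (m - c) (YW u (m - (m - c)) w) = YW v (m - c) (YW u c w).
  by have -> : m - (m - c) = c by lia.
have {}r2 := represents_ext e2 r2.
(* The common exponent includes [K.+1] so that it exceeds the degree of the polynomial
   correction. *)
have {}r1 := representsD (K.+1 + k2)%N r1; have {}r2 := representsD (K.+1 + k1)%N r2.
have k12 : (K.+1 + k1 + k2 = K.+1 + k2 + k1)%N by lia.
rewrite k12 !addSn in r1 r2.
case: hW => _ _ trunc _ _; have [Nv vN] := trunc v w; have [Nu uN] := trunc u w.
have leKk : (K <= K + k2 + k1)%N by lia.
have -> : b = m - a by rewrite /m addrAC subrr add0r.
have -> : a + (m - a) = m by lia.
apply: (@represents_commutator _ _ _ _ _ _ _ (m - Nv + 1) Nu F0 leKk r1 r2).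
  by move=> c lec; rewrite vN ?(lin_op0 (YW_linr _ _)) //; lia.
by move=> c ltc; rewrite uN ?(lin_op0 (YW_linr _ _)).
Qed.

End PhiCoordinated.

(** * Products of the generators in the vacuum module *)

Section VacuumProducts.
Variables (F : fieldType) (V : lmodType F) (l1 l2 l3 : F) (Lb Ib : int -> V -> V).
Variable vac : V.
Hypothesis hV : frakL_vacuum_module l1 l2 l3 Lb Ib vac.

Lemma Lb_vac n : 0 <= n -> Lb n vac = 0.
Proof. by case: hV => _ van /van[]. Qed.

Lemma Ib_vac n : 0 <= n -> Ib n vac = 0.
Proof. by case: hV => _ van /van[]. Qed.

Lemma LbLb_vac j : 0 <= j -> Lb j (Lb (-1) vac) =
  (j + 1)%:~R *: Lb (j - 2) vac + (if j == 3 then 6 / 12 * l1 else 0) *: vac.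
Proof.
move=> j0; case: hV => -[linL _ LL _ _] _.
have := LL j (-1) vac; rewrite (Lb_vac j0) (lin_op0 (linL _)) subr0 => ->.
have -> : j - -1 = j + 1 by lia.
have -> : j + -1 - 1 = j - 2 by lia.
congr (_ + _ *: _); have [->|nj] := eqVneq j 3; first by rewrite eqxx.
by rewrite ifF //; lia.
Qed.

Lemma LbIb_vac j : 0 <= j -> Lb j (Ib (-1) vac) =
  Ib (j - 2) vac - (if j == 2 then 2 * l2 else 0) *: vac.
Proof.
move=> j0; case: hV => -[_ linI _ LI _] _.
have := LI j (-1) vac; rewrite (Lb_vac j0) (lin_op0 (linI _)) subr0 => ->.
have -> : j + -1 - 1 = j - 2 by lia.
rewrite scaleN1r opprK; congr (_ - _ *: _).
have [->|nj] := eqVneq j 2; first by rewrite eqxx.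
by rewrite ifF //; lia.
Qed.

Lemma IbLb_vac j : 3 <= j -> Ib j (Lb (-1) vac) = 0.
Proof.
move=> j0; case: hV => -[linL _ _ LI _] _.
have := LI (-1) j vac; rewrite !Ib_vac ?(lin_op0 (linL _)); try lia.
rewrite scaler0 ifF ?scale0r; last by lia.
by rewrite sub0r subr0 => /oppr_inj.
Qed.

Lemma IbIb_vac j : 0 <= j ->
  Ib j (Ib (-1) vac) = (if j == 1 then l3 else 0) *: vac.
Proof.
move=> j0; case: hV => -[_ linI _ _ II] _.
have := II j (-1) vac; rewrite (Ib_vac j0) (lin_op0 (linI _)) subr0 => ->.
have [->|nj] := eqVneq j 1; first by rewrite eqxx mul1r.
by rewrite ifF //; lia.
Qed.

End VacuumProducts.

Lemma commutator_add_scalar (F : fieldType) (M : lmodType F) (f g : M -> M) (c d : F) x :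
  lin_op f -> lin_op g ->
  f (g x + d *: x) + c *: (g x + d *: x) - (g (f x + c *: x) + d *: (f x + c *: x)) =
  f (g x) - g (f x).
Proof.
move=> hf hg; rewrite (lin_opD hf) (lin_opZ hf) (lin_opD hg) (lin_opZ hg) !scalerDr.
rewrite !scalerA [d * c]mulrC -(addrA (f (g x))) -(addrA (g (f x))) [X in _ - (_ + X)]addrCA.
by rewrite opprD addrACA subrr addr0.
Qed.

(** * Commutators of the two generating fields on [W] *)

Section Brackets.
Variables (F : fieldType) (F0 : [pchar F] =i pred0) (l1 l2 l3 : F).
Variables (V : lmodType F) (Lb Ib : int -> V -> V) (vac : V) (Y : V -> int -> V -> V).
Hypotheses (hV : frakL_vacuum_module l1 l2 l3 Lb Ib vac) (hY : vertex_algebra Y vac).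
Hypothesis hYL : forall (m : int) (v : V), Y (Lb (-1) vac) m v = Lb (- m - 1) v.
Hypothesis hYI : forall (m : int) (v : V), Y (Ib (-1) vac) m v = Ib (- m - 1) v.
Variables (W : lmodType F) (YW : V -> int -> W -> W).
Hypothesis hW : phi_coordinated_module Y vac YW.

Let YL := YW (Lb (-1) vac).
Let YI := YW (Ib (-1) vac).

Lemma YW_vac n w : YW vac n w = if n == 0 then w else 0.
Proof. by case: hW. Qed.

(** [Lb (-2) vac] is the translate of the generator, on which [D] acts as [x d/dx]. *)
Lemma YW_Lb2 m w : YW (Lb (-2) vac) m w = m%:~R *: YL m w.
Proof.
rewrite -[_%:~R]expr1 -[_ ^+ 1]divr1 -(YW_translation F0 hY hW _ 1) hYL.
by congr YW; lia.
Qed.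

Lemma YW_Ib2 m w : YW (Ib (-2) vac) m w = m%:~R *: YI m w.
Proof.
rewrite -[_%:~R]expr1 -[_ ^+ 1]divr1 -(YW_translation F0 hY hW _ 1) hYI.
by congr YW; lia.
Qed.

Lemma mode_L (j : nat) v : Y (Lb (-1) vac) (- j%:Z - 1) v = Lb j%:Z v.
Proof. by rewrite hYL; congr (Lb _ v); lia. Qed.

Lemma mode_I (j : nat) v : Y (Ib (-1) vac) (- j%:Z - 1) v = Ib j%:Z v.
Proof. by rewrite hYI; congr (Ib _ v); lia. Qed.

(** The nonzero products are [Lb (-2) vac], [2 Lb (-1) vac] and [(l1/2) vac] for [j = 0, 1, 3]. They
    contribute [a + b], [-2a] and the central term [-a^3 l1/12]. *)
Lemma commutator_LL a b w : YL a (YL b w) - YL b (YL a w) =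
  (b - a)%:~R *: YL (a + b) w
  - (if a + b == 0 then (a * a * a)%:~R / 12%:R * l1 else 0) *: w.
Proof.
have LL0 n : n < - 4%:Z -> Y (Lb (-1) vac) n (Lb (-1) vac) = 0.
  by move=> ln; rewrite hYL (LbLb_vac hV) ?(Lb_vac hV) ?scaler0 ?ifF ?scale0r ?addr0 //; lia.
rewrite /YL (@phi_commutator _ _ _ _ _ _ F0 hY hW _ _ 3) //.
under eq_bigr => j _ do rewrite mode_L.
rewrite !big_ord_recl big_ord0 /= /bump /= !addr0 !(LbLb_vac hV) //.
rewrite (_ : (0%:Z - 2) = -2) // (_ : (1%:Z - 2) = -1) //.
rewrite ![Lb (_ - 2) vac](Lb_vac hV) // !scale0r !scaler0 !addr0 add0r.
rewrite !(lin_op0 (YW_linl hW _ _)) add0r !(lin_opZ (YW_linl hW _ _)) YW_Lb2 YW_vac.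
rewrite scaler0 add0r !scalerA addrA -scalerDl -scaleNr; congr (_ *: _ + _).
  by rewrite expr1 !divr1 !rmorphB !rmorphD rmorphN /=; ring.
have [_|_] := eqVneq (a + b) 0; last by rewrite oppr0 scaler0 scale0r.
congr (_ *: _); rewrite -[(1 + _)`!]/6%N !rmorphM rmorphN /=.
by field; rewrite ?(natf_eq0 F0).
Qed.

(** Here [j = 0, 1, 2] give [Ib (-2) vac], [Ib (-1) vac] and [-2 l2 vac], hence [(a + b) - a = b]
    and the central term [-a^2 l2]. *)
Lemma commutator_LI a b w : YL a (YI b w) - YI b (YL a w) =
  b%:~R *: YI (a + b) w - (if a + b == 0 then (a * a)%:~R * l2 else 0) *: w.
Proof.
have LI0 n : n < - 4%:Z -> Y (Lb (-1) vac) n (Ib (-1) vac) = 0.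
  by move=> ln; rewrite hYL (LbIb_vac hV) ?(Ib_vac hV) ?ifF ?scale0r ?subr0 //; lia.
have IL0 n : n < - 4%:Z -> Y (Ib (-1) vac) n (Lb (-1) vac) = 0.
  by move=> ln; rewrite hYI (IbLb_vac hV) //; lia.
rewrite /YL /YI (@phi_commutator _ _ _ _ _ _ F0 hY hW _ _ 3) //.
under eq_bigr => j _ do rewrite mode_L.
rewrite !big_ord_recl big_ord0 /= /bump /= !addr0 !(LbIb_vac hV) //.
rewrite (_ : (0%:Z - 2) = -2) // (_ : (1%:Z - 2) = -1) //.
rewrite ![Ib (_ - 2) vac](Ib_vac hV) // !scale0r !subr0 ?addr0 ?add0r.
rewrite -!scaleNr !(lin_op0 (YW_linl hW _ _)) !(lin_opZ (YW_linl hW _ _)) YW_Ib2 YW_vac.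
rewrite scaler0 addr0 !scalerA addrA -scalerDl; congr (_ *: _ + _).
  by rewrite expr1 !divr1 !rmorphD rmorphN /=; ring.
have [_|_] := eqVneq (a + b) 0; last by rewrite oppr0 scaler0 scale0r.
congr (_ *: _); rewrite -[(1 + _)`!]/2%N !rmorphM rmorphN /=.
by field; rewrite ?(natf_eq0 F0).
Qed.

Lemma commutator_II a b w : YI a (YI b w) - YI b (YI a w) =
  (if a + b == 0 then - a%:~R * l3 else 0) *: w.
Proof.
have II0 n : n < - 4%:Z -> Y (Ib (-1) vac) n (Ib (-1) vac) = 0.
  by move=> ln; rewrite hYI (IbIb_vac hV) ?ifF ?scale0r //; lia.
rewrite /YI (@phi_commutator _ _ _ _ _ _ F0 hY hW _ _ 3) //.
under eq_bigr => j _ do rewrite mode_I.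
rewrite !big_ord_recl big_ord0 /= /bump /= !addr0 !(IbIb_vac hV) //= !scale0r.
rewrite !(lin_op0 (YW_linl hW _ _)) !(lin_opZ (YW_linl hW _ _)) YW_vac.
rewrite !scaler0 !addr0 add0r scalerA.
have [_|_] := eqVneq (a + b) 0; last by rewrite scaler0 scale0r.
by rewrite expr1 divr1 rmorphN.
Qed.

End Brackets.

(** * The module structure over the twisted Heisenberg-Virasoro algebra *)

Theorem theorem2p11 (F : fieldType) (hF : [pchar F] =i pred0) (l1 l2 l3 : F)
  (V : lmodType F) (Lb Ib : int -> V -> V) (vac : V) (Y : V -> int -> V -> V)
  (hV : frakL_vacuum_module l1 l2 l3 Lb Ib vac)
  (hU : induced_universal l1 l2 l3 Lb Ib vac)
  (hY : vertex_algebra Y vac)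
  (hYL : forall (m : int) (v : V), Y (Lb (-1) vac) m v = Lb (- m - 1) v)
  (hYI : forall (m : int) (v : V), Y (Ib (-1) vac) m v = Ib (- m - 1) v)
  (W : lmodType F) (YW : V -> int -> W -> W)
  (hW : phi_coordinated_module Y vac YW) :
  exists L I : int -> W -> W,
    [/\ calL_module l1 l2 l3 L I,
        restricted L I,
        (forall (m : int) (w : W),
           YW (Lb (-1) vac) m w = L (- m) w - (if m == 0 then l1 / 24%:R else 0) *: w)
      & (forall (m : int) (w : W),
           YW (Ib (-1) vac) m w = I (- m) w - (if m == 0 then l2 else 0) *: w)].
Proof.
(* Scalar shifts of the zero modes leave commutators unchanged but alter the right sides when
   [m + n = 0]: [2m l1/24] turns [m^3/12] into [(m^3 - m)/12], and [l2] turns [m^2] into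
   [m^2 + m]. *)
pose shifted (u : V) (c : F) (n : int) w := YW u (- n) w + (if n == 0 then c else 0) *: w.
have shifted_lin u c n : lin_op (shifted u c n).
  move=> d x y; rewrite /shifted (YW_linr hW) !scalerDr !scalerA addrACA.
  by rewrite [_ * d]mulrC.
have shiftedE u c m w : YW u m w = shifted u c (- m) w - (if m == 0 then c else 0) *: w.
  by rewrite /shifted opprK oppr_eq0 addrK.
have comm u v c d m n w : shifted u c m (shifted v d n w) - shifted v d n (shifted u c m w) =
    YW u (- m) (YW v (- n) w) - YW v (- n) (YW u (- m) w).
  exact: commutator_add_scalar (YW_linr hW _ _) (YW_linr hW _ _).
exists (shifted (Lb (-1) vac) (l1 / 24%:R)), (shifted (Ib (-1) vac) l2); split=> //.
- split=> // m n w; rewrite comm /shifted.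
  + rewrite (commutator_LL hF hV hY hYL hW) -(opprD m n) oppr_eq0 scalerDr.
    rewrite -addrA scalerA -scalerDl -scaleNr; congr (_ *: _ + _ *: _); first by congr (_%:~R); lia.
    have [mn|_] := eqVneq (m + n) 0; last by rewrite mulr0 addr0 oppr0.
    have -> : n = - m by lia.
    rewrite opprK !rmorphD !rmorphN !rmorphM !rmorphN /=.
    by field; rewrite ?(natf_eq0 hF).
  + rewrite (commutator_LI hF hV hY hYL hYI hW) -(opprD m n) oppr_eq0 -!scaleNr.
    rewrite scalerDr -addrA scalerA -scalerDl; congr (_ *: _ + _ *: _); first by rewrite rmorphN.
    have [mn|_] := eqVneq (m + n) 0; last by rewrite mulr0 oppr0 addr0.
    have -> : n = - m by lia.
    by rewrite !rmorphD !rmorphM !rmorphN /=; ring.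
  + rewrite (commutator_II hF hV hY hYI hW) -(opprD m n) oppr_eq0; congr (_ *: _).
    by rewrite rmorphN opprK.
- move=> w; case: hW => _ _ trunc _ _.
  have [N1 h1] := trunc (Lb (-1) vac) w; have [N2 h2] := trunc (Ib (-1) vac) w.
  (* The bound [0] keeps [n] positive, where no scalar is added. *)
  exists (Order.max 0 (Order.max (- N1) (- N2))) => n ltn.
  by rewrite /shifted h1 ?h2 ?ifF ?scale0r ?addr0 //; lia.
Qed.
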